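(* Let $k\ge 1$ and $n$ be integers with $2k+1\le n$. Let $Q_{n,k}$ be the word $$Q_{n,k} := s_{n-k-1}\cdots s_1\ \ s_{n-k-1}\cdots s_2\ \ \cdots\ \ s_{n-k-1}s_{n-k-2}\ \ s_{n-k-1}$$ in the simple transpositions $s_i=(i,i+1)$ of $\mathfrak{S}_{n-k}$ (a reduced word for the longest element $[n-k,\ldots,1]$ of $\mathfrak{S}_{n-k}$), and let $Q'_{n,k}$ be the word obtained from $Q_{n,k}$ by deleting all letters $s_i$ with $1\le i\le k$. Let $$\pi_{n,k}:=[1,\ldots,k,\,n-k,\,n-k-1,\ldots,k+1]\in\mathfrak{S}_{n-k}$$ (one-line notation). Then $\Delta_{n,k}=\Delta(Q'_{n,k},\pi_{n,k})$, where the vertices of the two complexes are identified as follows: the letters of $Q'_{n,k}$ are in bijection with $\Gamma_{n,k}$, the letter corresponding to the diagonal $\overline{ij}$ ($i<j$) being $s_{n-j+i}$, and the letters of $Q'_{n,k}$ listed from left to right correspond to the diagonals of $\Gamma_{n,k}$ ordered by decreasing $j$ (from $j=n$ downward) and, for fixed $j$, by decreasing $i$.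
   Context: Label the vertices of a convex $n$-gon by $1,\ldots,n$ in cyclic order, and write $\overline{ij}$ for the segment joining $i$ and $j$. Set $\Gamma_{n,k}:=\{\overline{ij}: k<|i-j|<n-k\}$. A $(k+1)$-crossing is a set of $k+1$ diagonals which mutually cross (in their interiors). A $k$-triangulation is a maximal subset of $\Gamma_{n,k}$ containing no $(k+1)$-crossing. $\Delta_{n,k}$ is the simplicial complex on vertex set $\Gamma_{n,k}$ whose facets are the $k$-triangulations (faces are subsets of $k$-triangulations). For a word $Q=w_1\cdots w_r$ in the simple transpositions of a symmetric group and a permutation $\pi$, the subword complex $\Delta(Q,\pi)$ is the simplicial complex on the vertex set of positions $\{1,\ldots,r\}$ of $Q$ (distinct positions are distinct vertices even if the letters coincide) whose facets are the sets of positions whose complement (as a subword of $Q$) is a reduced word for $\pi$; equivalently a set of positions is a face iff its complementary subword contains a reduced word for $\pi$. *)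

(* Defs.v *)
From mathcomp Require Import all_boot all_fingroup.
Unset Printing Implicit Defensive.

(* A word is a seq nat; the letter i stands for s_i = (i, i+1), 1 <= i <= N-1,
   acting on {1..N}, which we model 0-based as 'I_N (value m <-> point m+1),
   so s_i swaps the ordinals i-1 and i. *)
Definition sti (N i : nat) : {perm 'I_N} :=
  match (insub i.-1 : option 'I_N), (insub i : option 'I_N) with
  | Some a, Some b => tperm a b
  | _, _ => 1%g
  end.

Definition wprod (N : nat) (w : seq nat) : {perm 'I_N} :=
  (\prod_(a <- w) sti N a)%g.

Definition letters_ok (N : nat) (w : seq nat) : bool :=
  all (fun a => 0 < a < N) w.

Definition represents (N : nat) (w : seq nat) (pi : seq nat) : Prop :=
  forall x : 'I_N, (wprod N w x).+1 = nth 0 pi x.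

Definition reduced_for (N : nat) (w : seq nat) (pi : seq nat) : Prop :=
  [/\ letters_ok N w, represents N w pi &
      forall w', letters_ok N w' -> represents N w' pi -> size w <= size w'].

Definition compl_subword (Q : seq nat) (F : {set 'I_(size Q)}) : seq nat :=
  mask [seq i \notin F | i <- enum 'I_(size Q)] Q.

Definition subword_face (N : nat) (Q : seq nat) (pi : seq nat)
  (F : {set 'I_(size Q)}) : Prop :=
  exists w, subseq w (compl_subword Q F) /\ reduced_for N w pi.

Definition Qword (n k : nat) : seq nat :=
  let N := n - k in
  flatten [seq rev (iota b (N - b)) | b <- iota 1 N.-1].

Definition Qprime (n k : nat) : seq nat := [seq a <- Qword n k | k < a].

Definition pi_nk (n k : nat) : seq nat :=
  iota 1 k ++ rev (iota k.+1 (n - k - k)).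

(* vertices 1..n (as elements of 'I_n.+1, 0 unused); a diagonal ij with i<j
   is the pair (i, j) *)
Definition diag (n : nat) := ('I_n.+1 * 'I_n.+1)%type.

Definition Gamma (n k : nat) : {set diag n} :=
  [set d : diag n | [&& 0 < d.1, d.1 < d.2, k < d.2 - d.1 & d.2 - d.1 < n - k]].

(* two segments cross in their interiors iff their endpoints strictly interleave *)
Definition crosses (n : nat) (d e : diag n) : bool :=
  ((d.1 < e.1 < d.2) && (d.2 < e.2)) || ((e.1 < d.1 < e.2) && (e.2 < d.2)).

Definition has_crossing (n m : nat) (T : {set diag n}) : Prop :=
  exists C : {set diag n}, [/\ C \subset T, #|C| = m &
    {in C &, forall d e, d != e -> crosses n d e}].

Definition ktriang (n k : nat) (T : {set diag n}) : Prop :=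
  [/\ T \subset Gamma n k, ~ has_crossing n k.+1 T &
      forall T' : {set diag n}, T \subset T' -> T' \subset Gamma n k ->
        ~ has_crossing n k.+1 T' -> T' = T].

Definition kface (n k : nat) (S : {set diag n}) : Prop :=
  exists T, ktriang n k T /\ S \subset T.

Definition diag_list (n k : nat) : seq (diag n) :=
  [seq d <- [seq (i, j) | j <- rev (enum 'I_n.+1), i <- rev (enum 'I_n.+1)]
   | d \in Gamma n k].

Definition d0 (n : nat) : diag n := (ord0, ord0).

(* Main.v *)
(** Reading the word as a network of adjacent comparators (a letter acts only
    when it creates an inversion), the complement of [F] contains a reduced
    word for [pi_nk] iff the network sorts, and by the 0-1 principle it is
    enough to follow, for each threshold [B], the number [h x] of values [>= B]
    among the first [x] places.  A comparator at [a] replaces [h a] by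
    [min (h (a-1) + 1) (h (a+1))].  In the row of diagonals with [j = n - t],
    [i = x - t], this is a last-passage recurrence in which each deleted letter
    met along a path costs one row.  The word has exactly [k] spare rows, so
    sorting fails for the threshold [B] iff some path meets [k + 1] deleted
    letters; their diagonals satisfy
    [i_0 < ... < i_k <= B < j_0 < ... < j_k], which is a [(k+1)]-crossing. *)
Require Import Defs.
From mathcomp Require Import all_boot all_fingroup.
From mathcomp Require Import zify.

(** * Permutations and comparator networks *)

Lemma stiP {N : nat} (s : {perm 'I_N}) {a : nat} : 0 < a < N ->
  exists u v : 'I_N,
    [/\ s u = a.-1 :> nat, s v = a :> nat & sti N a = tperm (s u) (s v)].
Proof.
move=> /andP[a0 aN]; have pN : a.-1 < N by lia.
exists (s^-1%g (Ordinal pN)), (s^-1%g (Ordinal aN)).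
rewrite !permKV; split=> //.
by rewrite /sti !insubT /=; congr tperm; apply: val_inj.
Qed.

Lemma wprod_cons (N a : nat) (w : seq nat) :
  wprod N (a :: w) = (sti N a * wprod N w)%g.
Proof. by rewrite /wprod big_cons. Qed.

Lemma wprod_rcons (N a : nat) (w : seq nat) :
  wprod N (rcons w a) = (wprod N w * sti N a)%g.
Proof. by rewrite /wprod -cats1 big_cat big_seq1. Qed.

(** Here [e] is a value and [s e] its place, so multiplying [s] on the right by [sti N a] swaps the
    contents of places [a.-1] and [a]. *)
Definition height {N : nat} (s : {perm 'I_N}) (B x : nat) : nat :=
  #|[set e : 'I_N | (B <= e) && (s e < x)]|.

(** With the larger value moved to place [a.-1], the count at [a] is [h a.-1] plus one if either
    value is [>= B]. As [h a.+1] is [h a.-1] plus the number of such values, this is the minimum. *)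
Definition comparator (a : nat) (h : nat -> nat) (x : nat) : nat :=
  if x == a then minn (h a.-1).+1 (h a.+1) else h x.

Definition network (h : nat -> nat) (w : seq nat) : nat -> nat :=
  foldl (fun h a => comparator a h) h w.

Lemma heightS {N : nat} (s : {perm 'I_N}) (B : nat) (e : 'I_N) :
  height s B (s e).+1 = (B <= e) + height s B (s e).
Proof.
rewrite /height (cardsD1 e) inE ltnSn andbT; congr (_ + _).
apply: eq_card => f; rewrite !inE ltnS (leq_eqVlt (s f)).
have [->|nfe] := eqVneq f e; first by rewrite ltnn andbF.
suff /negbTE -> : (s f != s e :> nat) by [].
by apply: contra nfe => /eqP/val_inj/perm_inj ->.
Qed.

Lemma height_sti_neq {N : nat} (s : {perm 'I_N}) (B a x : nat) :
  0 < a < N -> x != a -> height (s * sti N a)%g B x = height s B x.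
Proof.
move=> aN xa; have [u [v [su sv ->]]] := stiP s aN.
apply: eq_card => e; rewrite !inE permM; congr (_ && _).
by case: tpermP => // ->; lia.
Qed.

Lemma height_sti_eq {N : nat} {s : {perm 'I_N}} (B : nat) {a : nat} {u v : 'I_N} :
  0 < a < N -> s u = a.-1 :> nat -> s v = a :> nat ->
  sti N a = tperm (s u) (s v) ->
  height (s * sti N a)%g B a = (B <= v) + height s B a.-1.
Proof.
move=> aN su sv sE.
have sv' : (s * sti N a)%g v = a.-1 :> nat by rewrite permM sE tpermR.
have := heightS (s * sti N a)%g B v; rewrite sv' prednK; last by lia.
by move=> ->; rewrite height_sti_neq //; lia.
Qed.

Lemma height_step {N : nat} {s : {perm 'I_N}} (B : nat) {a : nat} {u v : 'I_N} :
  0 < a < N -> s u = a.-1 :> nat -> s v = a :> nat ->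
  height s B a = (B <= u) + height s B a.-1 /\
  height s B a.+1 = (B <= v) + ((B <= u) + height s B a.-1).
Proof.
move=> aN su sv; have := heightS s B u; rewrite su prednK; last by lia.
by have := heightS s B v; rewrite sv => -> ->.
Qed.

(** Kept or skipped, the letter makes the count at [a] exceed that at [a.-1] by the indicator of a
    single value, and the count at [a.+1] dominates both outcomes. *)
Lemma height_sti_le {N : nat} {s : {perm 'I_N}} {B a : nat} (x : nat) {h : nat -> nat} :
  0 < a < N -> (forall y, height s B y <= h y) ->
  height s B x <= comparator a h x /\
  height (s * sti N a)%g B x <= comparator a h x.
Proof.
move=> aN sh; rewrite /comparator.
have [->|xa] := eqVneq x a; last by rewrite height_sti_neq // sh.
have [u [v [su sv sE]]] := stiP s aN.
rewrite (height_sti_eq _ aN su sv sE) //.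
have [-> hS] := height_step B aN su sv.
by have := sh a.-1; have := sh a.+1; rewrite hS; lia.
Qed.

Lemma height_subseq_le {N : nat} (B x : nat) (w r : seq nat)
    (s : {perm 'I_N}) (h : nat -> nat) :
  letters_ok N r -> subseq w r -> (forall y, height s B y <= h y) ->
  height (s * wprod N w)%g B x <= network h r x.
Proof.
elim: r w s h => [|a r IH] w s h /=.
  by move=> _ /eqP -> sh; rewrite /wprod big_nil mulg1.
case/andP=> aN okr; case: w => [|b w].
  move=> _ sh; apply: IH => //; first exact: sub0seq.
  by move=> y; have [] := height_sti_le y aN sh.
case: eqP => [->|_] wr sh; last first.
  by apply: IH => // y; have [] := height_sti_le y aN sh.
by rewrite wprod_cons mulgA; apply: IH => // y; have [] := height_sti_le y aN sh.
Qed.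

Definition inversions {N : nat} (s : {perm 'I_N}) : {set 'I_N * 'I_N} :=
  [set p : 'I_N * 'I_N | (p.1 < p.2) && (s p.2 < s p.1)].

(** Nothing lies strictly between [p] and [q], so swapping them can reverse no other pair. *)
Lemma tperm_adjacent_lt {N : nat} (p q y z : 'I_N) :
  p.+1 = q -> y < z -> ~~ ((y == p) && (z == q)) ->
  tperm p q y < tperm p q z.
Proof.
move=> pq; rewrite -!val_eqE /=.
by case: (tpermP p q y) => [->|->|/eqP + /eqP +]; case: (tpermP p q z)
  => [->|->|/eqP + /eqP +]; rewrite -?val_eqE /=; lia.
Qed.

Lemma card_inversions_sti_le {N : nat} (s : {perm 'I_N}) {a : nat} :
  0 < a < N -> #|inversions (s * sti N a)%g| <= #|inversions s|.+1.
Proof.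
move=> aN; have [u [v [su sv ->]]] := stiP s aN.
have sub : inversions (s * tperm (s u) (s v))%g \subset (u, v) |: inversions s.
  apply/subsetP=> -[e f]; rewrite !inE /= !permM => /andP[ef sfe].
  rewrite ef /=; case: (ltngtP (s e) (s f)) => [slt|_|/val_inj/perm_inj eE];
    rewrite ?orbT //; last by rewrite eE ltnn in ef.
  rewrite orbF xpair_eqE; apply: contraLR sfe => neq; rewrite -leqNgt ltnW //.
  by apply: tperm_adjacent_lt => //; [lia | rewrite !(inj_eq perm_inj)].
by apply: leq_trans (subset_leq_card sub) _; rewrite cardsU1; case: (_ \notin _).
Qed.

Lemma card_inversions_sti_gt {N : nat} {s : {perm 'I_N}} {a : nat} {u v : 'I_N} :
  0 < a < N -> s u = a.-1 :> nat -> s v = a :> nat ->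
  sti N a = tperm (s u) (s v) -> u < v ->
  #|inversions s| < #|inversions (s * sti N a)%g|.
Proof.
move=> aN su sv -> uv; apply: proper_card; apply/properP; split; last first.
  exists (u, v); rewrite !inE /= ?permM ?tpermL ?tpermR uv /=; lia.
apply/subsetP=> -[e f]; rewrite !inE /= !permM => /andP[ef sfe].
rewrite ef /=; apply: tperm_adjacent_lt => //; first by lia.
by rewrite !(inj_eq perm_inj); apply: contraTN ef => /andP[/eqP-> /eqP->]; lia.
Qed.

(** Each letter creates at most one inversion. This lower bound on length later certifies that the
    greedy subword is reduced. *)
Lemma card_inversions_wprod {N : nat} (w : seq nat) :
  letters_ok N w -> #|inversions (wprod N w)| <= size w.
Proof.
elim/last_ind: w => [|w a IH].
  rewrite /wprod big_nil (_ : inversions _ = set0) ?cards0 //.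
  by apply/setP=> -[e f]; rewrite !inE !perm1; lia.
rewrite /letters_ok all_rcons size_rcons wprod_rcons => /andP[aN /IH le].
by apply: leq_trans (card_inversions_sti_le _ aN) _.
Qed.

(* The witness keeps a letter exactly when it creates an inversion. *)
Lemma greedy_subword {N : nat} (r : seq nat) (s : {perm 'I_N}) :
  letters_ok N r ->
  exists w : seq nat, [/\ subseq w r,
    size w + #|inversions s| <= #|inversions (s * wprod N w)%g| &
    forall B x h, (forall y, y <= N -> height s B y = h y) -> x <= N ->
      height (s * wprod N w)%g B x = network h r x].
Proof.
elim: r s => [|a r IH] s /=.
  by exists [::]; rewrite /wprod big_nil mulg1; split=> // B x h sh xN; rewrite sh.
case/andP=> aN okr; have [u [v [su sv sE]]] := stiP s aN.
case: (ltnP u v) => uv.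
  have [w [wr szw hw]] := IH (s * sti N a)%g okr.
  exists (a :: w); rewrite wprod_cons mulgA /= eqxx; split=> //.
    apply: leq_trans szw; rewrite addSn -addnS leq_add2l.
    exact: card_inversions_sti_gt sv sE uv.
  move=> B x h sh; apply: hw => y yN; rewrite /comparator.
  have [->|ya] := eqVneq y a; last by rewrite height_sti_neq // sh.
  rewrite (height_sti_eq _ aN su sv sE) // -!sh; try lia.
  by have [_ ->] := height_step B aN su sv; lia.
(* The larger value already sits at place [a.-1], so the letter is skipped and the comparator
   changes nothing. *)
have [w [wr szw hw]] := IH s okr.
exists w; split=> //; first exact: subseq_trans wr (subseq_cons _ _).
move=> B x h sh; apply: hw => y yN; rewrite /comparator.
have [->|_] := eqVneq y a; last exact: sh.
rewrite -!sh; try lia.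
by have [-> ->] := height_step B aN su sv; lia.
Qed.

Lemma height1_le {N : nat} (B x : nat) : x <= N -> height (1 : {perm 'I_N}) B x = x - B.
Proof.
elim: x => [_|x IH xN]; first by apply: eq_card0 => e; rewrite !inE andbF.
by have := heightS (1 : {perm 'I_N}) B (Ordinal xN); rewrite perm1 /= IH; lia.
Qed.

(** Beyond [N] the height is constant while [x - B] may grow, so only an inequality survives;
    [height_subseq_le] asks for it at every place. *)
Lemma height1_ub {N : nat} (B x : nat) : height (1 : {perm 'I_N}) B x <= x - B.
Proof.
have [xN|Nx] := leqP x N; first by rewrite height1_le.
have -> : height (1 : {perm 'I_N}) B x = height (1 : {perm 'I_N}) B N.
  by apply: eq_card => e; rewrite !inE perm1 ltn_ord (ltn_trans _ Nx).
by rewrite height1_le //; lia.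
Qed.

Lemma wprod_fix {N : nat} (k : nat) (w : seq nat) (e : 'I_N) :
  all (fun a => k < a < N) w -> e < k -> wprod N w e = e.
Proof.
move=> + ek; elim/last_ind: w => [|w a IH]; first by rewrite /wprod big_nil perm1.
rewrite all_rcons wprod_rcons permM => /andP[aN /IH ->].
have [|u [v [su sv ->]]] := @stiP N 1%g a; first by lia.
by apply: tpermD; rewrite -val_eqE /= ?su ?sv; lia.
Qed.

(** * The profile of the word along its rows *)


Lemma network_cat (h : nat -> nat) (w r : seq nat) :
  network h (w ++ r) = network (network h w) r.
Proof. exact: foldl_cat. Qed.

(** The letters run downwards: when [x] acts, the entry at [x.-1] is still the old one and the entry
    at [x.+1] is already updated. *)
Lemma network_sweep (P : pred nat) (h : nat -> nat) (c l x : nat) : 0 < c ->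
  let h' := network h [seq y <- rev (iota c l) | P y] in
  h' x = if (c <= x < c + l) && P x then minn (h x.-1).+1 (h' x.+1) else h x.
Proof.
move=> c0 /=; elim: l c c0 x => [|l IH] c c0 x.
  by rewrite /= (_ : c <= x < c + 0 = false) //; lia.
rewrite /= rev_cons filter_rcons; have {}IH := IH c.+1 isT.
set h1 := network h _ in IH.
have h1lt y : y <= c -> h1 y = h y by move=> yc; rewrite IH ltnNge yc.
have -> : network h (if P c then rcons [seq y <- rev (iota c.+1 l) | P y] c
    else [seq y <- rev (iota c.+1 l) | P y]) =
    if P c then comparator c h1 else h1.
  by case: (P c) => //; rewrite -cats1 network_cat.
have [->|xc] := eqVneq x c.
  rewrite leqnn (_ : c < c + l.+1) /=; last by lia.
  case: (P c); last by rewrite h1lt.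
  rewrite /comparator eqxx (_ : c.+1 == c = false); last by lia.
  by rewrite (h1lt c.-1) ?leq_pred.
have {1}-> : (if P c then comparator c h1 else h1) x = h1 x.
  by case: (P c) => //; rewrite /comparator (negbTE xc).
rewrite IH addSnnS; have [xlt|xge] := ltnP x c; last first.
  rewrite (_ : c < x); last by lia.
  case: ifP => // _; congr minn.
  by case: (P c) => //; rewrite /comparator (_ : x.+1 == c = false) //; lia.
by rewrite (_ : c < x = false) //; lia.
Qed.

(** With [i = x - t] and [j = n - t], the bound [t < x] says [i >= 1], and [k < x < n - k] says
    [k < j - i < n - k]. *)
Definition row (n k t : nat) : seq (nat * nat) :=
  let c := maxn t.+1 k.+1 in [seq (x - t, n - t) | x <- rev (iota c (n - k - c))].

Definition rows (n k t : nat) : seq (nat * nat) :=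
  flatten [seq row n k r | r <- iota 0 t].

Definition letter (n : nat) (e : nat * nat) : nat := n - e.2 + e.1.

Lemma row_letters (n k t : nat) (P : pred (nat * nat)) :
  let c := maxn t.+1 k.+1 in
  [seq letter n e | e <- row n k t & P e] =
  [seq x <- rev (iota c (n - k - c)) | P (x - t, n - t)].
Proof.
rewrite /row filter_map -map_comp /=.
rewrite -[RHS]map_id; apply/eq_in_map => x.
by rewrite mem_filter mem_rev mem_iota /letter /=; lia.
Qed.

(* [profile n k D B t x] counts the values [>= B] among the first [x] places
   after the comparators of rows [0 .. t-1] outside [D]. *)
Definition profile (n k : nat) (D : pred (nat * nat)) (B t : nat) : nat -> nat :=
  network (subn^~ B) [seq letter n e | e <- rows n k t & ~~ D e].

Lemma rowsS (n k t : nat) : rows n k t.+1 = rows n k t ++ row n k t.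
Proof. by rewrite /rows -addn1 iotaD map_cat flatten_cat /= cats0. Qed.

Lemma profileS (n k : nat) (D : pred (nat * nat)) (B t x : nat) :
  profile n k D B t.+1 x =
  if [&& t < x, k < x, x < n - k & ~~ D (x - t, n - t)]
  then minn (profile n k D B t x.-1).+1 (profile n k D B t.+1 x.+1)
  else profile n k D B t x.
Proof.
rewrite {1 3}/profile rowsS filter_cat map_cat network_cat row_letters.
rewrite -/(profile n k D B t) [LHS]network_sweep; last by rewrite leq_max.
have -> // : (maxn t.+1 k.+1 <= x < maxn t.+1 k.+1 + (n - k - maxn t.+1 k.+1)) =
  [&& t < x, k < x & x < n - k] by lia.
by rewrite -!andbA.
Qed.

Lemma profile_ge (n k : nat) (D : pred (nat * nat)) (B t x : nat) :
  x - B <= profile n k D B t x.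
Proof.
elim: t x => [|t IH] x //.
(* A row is filled from right to left, hence the inner induction on [n - x]. *)
have [m] := ubnP (n - x); elim: m x => // m IHm x xm.
rewrite profileS; case: ifP => // /and4P[tx kx xn _].
by have := IH x.-1; have := IHm x.+1; lia.
Qed.

Lemma profile_le (n k : nat) (D : pred (nat * nat)) (B t x : nat) :
  profile n k D B t x <= maxn t (x - B).
Proof.
elim: t x => [|t IH] x; first by rewrite max0n.
rewrite profileS; case: ifP => [/andP[tx _]|_]; last by have := IH x; lia.
by have := IH x.-1; lia.
Qed.

(** Row [t] contains only letters above [t], so place [x] is frozen after [x] rows. *)
Lemma profile_stable (n k : nat) (D : pred (nat * nat)) (B t x : nat) :
  x <= t -> profile n k D B t x = profile n k D B x x.
Proof.
move=> /subnK <-; elim: (t - x) => // d IH.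
by rewrite addSn profileS ltnNge leq_addl.
Qed.

Definition nested (d e : nat * nat) : bool := (d.1 < e.1) && (d.2 < e.2).

(** A deleted diagonal costs one row: the bound valid before row [t] persists after it. At [e]
    itself the entry is inherited; to the left of [e] in the same row it is at most its right
    neighbour; in later rows it is at most one more than the entry at [x.-1] one row earlier. *)
Lemma profile_chain_step (n k : nat) (D : pred (nat * nat)) (B r : nat)
    (e : nat * nat) :
  D e -> e.2 <= n ->
  (forall t x, n - e.2 <= t -> x <= t + e.1 -> profile n k D B t x + r <= t) ->
  forall t x, n - e.2 <= t -> x <= t + e.1 -> profile n k D B t.+1 x + r <= t.
Proof.
move=> De en skip; elim/ltn_ind => t IHt x.
have [m] := ubnP (t + e.1 - x); elim: m x => // m IHm x xm te xe.
rewrite profileS; case: ifP => [/and4P[tx kx xn NDx]|_]; last exact: skip.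
have [et|] := eqVneq (n - e.2) t; last first.
  move=> net; have tt : t.-1.+1 = t by lia.
  by have := IHt t.-1 _ x.-1; rewrite tt; lia.
have [xE|] := eqVneq x (t + e.1); last by have := IHm x.+1; lia.
case/negP: NDx; rewrite (_ : (_, _) = e) //.
by rewrite [e]surjective_pairing; congr pair; lia.
Qed.

(** The last diagonal of the chain lies in the earliest row. There [x <= t + e.1 <= t + B], so
    [profile_le] gives the bound [t]; every diagonal of the chain then costs one row. *)
Lemma profile_chain_le (n k : nat) (D : pred (nat * nat)) (B : nat)
    (e : nat * nat) (s : seq (nat * nat)) (t x : nat) :
  path nested e s -> all [pred d | [&& D d, d.1 <= B & d.2 <= n]] (e :: s) ->
  n - e.2 <= t -> x <= t + e.1 ->
  profile n k D B t.+1 x + size s <= t.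
Proof.
elim: s e t x => [|e' s IHs] e t x es /andP[/and3P[De eB en] Ds];
  apply: profile_chain_step => // {}t {}x te xe.
  by have := profile_le n k D B t x; rewrite /=; lia.
case/andP: es => /andP[ee1 ee2] es; case/andP: (Ds) => /and3P[_ _ en'] _.
have tt : t.-1.+1 = t by lia.
by have := IHs e' t.-1 x es Ds; rewrite tt /=; lia.
Qed.

(** Trace a deficient entry backwards through the recurrence. A deleted letter joins the chain and
    lowers both [t] and [d]; the branch [x.-1] lowers [t] and keeps [d] and [x - t]; the branch
    [x.+1] stays in the row. *)
Lemma profile_lt_chain (n k : nat) (D : pred (nat * nat)) (B d t x : nat) :
  d <= k -> d <= t -> k + t < x + d -> x + d <= B + t -> t.+1 - d + B <= n - k ->
  profile n k D B t.+1 x < t.+1 - d ->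
  exists s : seq (nat * nat),
    [/\ size s = d.+1, sorted nested s, all D s &
        all (fun e => [&& x - t <= e.1, e.1 <= B, B < e.2 & n - t <= e.2]) s].
Proof.
elim/ltn_ind: t d x => t IHt d x.
have [m] := ubnP (n - x); elim: m x => // m IHm x xm dk dt ktx xB tB.
rewrite profileS; case: ifP => [/and4P[tx kx xn NDx]|ND]; last first.
  (* The hypotheses give [t < x], [k < x] and [x < n - k], so the test can fail only through a
     deletion. *)
  have De : D (x - t, n - t) by apply: contraFT ND => ->; lia.
  case: d {IHm} dk dt ktx xB tB => [|d] dk dt ktx xB tB lt.
    by exists [:: (x - t, n - t)]; rewrite /= De; split=> //; lia.
  have tt : t.-1.+1 = t by lia.
  have := IHt t.-1 _ d x; rewrite tt => /(_ _ _ _ _ _ _ _)[]; try lia.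
  move=> s [szs ss Ds Bs]; exists ((x - t, n - t) :: s).
  rewrite /= szs De Ds; split=> //; last first.
    apply/andP; split; first by lia.
    by apply: sub_all Bs => e /=; lia.
  case: s Bs ss {szs Ds} => //= e s /andP[eB _] ->.
  by rewrite /nested /=; lia.
rewrite ltnNge leq_min negb_and -!ltnNge => /orP[lt|lt].
  have tt : t.-1.+1 = t by lia.
  have := IHt t.-1 _ d x.-1; rewrite tt => /(_ _ _ _ _ _ _ _)[]; try lia.
  move=> s [szs ss Ds Bs]; exists s; split=> //.
  by apply: sub_all Bs => e /=; lia.
have := profile_ge n k D B t.+1 x.+1.
(* On this boundary [x.+1 - B] equals [t.+1 - d], so the entry at [x.+1] cannot be deficient. *)
have [xE|xne] := eqVneq (x + d) (B + t); first by lia.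
have := IHm x.+1 => /(_ _ _ _ _ _ _ _)[]; try lia.
move=> s [szs ss Ds Bs] _; exists s; split=> //.
by apply: sub_all Bs => e /=; lia.
Qed.

(** * Letters and diagonals *)


Lemma filter_iota (P : pred nat) (a l b m : nat) :
  (forall x, (P x && (a <= x < a + l)) = (b <= x < b + m)) ->
  filter P (iota a l) = iota b m.
Proof.
move=> PE; apply: (irr_sorted_eq ltn_trans ltnn).
- exact: sorted_filter ltn_trans _ _ (iota_ltn_sorted _ _).
- exact: iota_ltn_sorted.
- by move=> x; rewrite mem_filter !mem_iota.
Qed.

(** From this row on [t.+1 >= n - k] and the rows are empty. This reconciles the [(n - k).-1] blocks
    of [Qword] with the [n.+1] values of [j] in [diag_list]. *)
Lemma rows_trunc (n k m : nat) : rows n k ((n - k).-1 + m) = rows n k (n - k).-1.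
Proof.
elim: m => [|m IH]; first by rewrite addn0.
rewrite addnS rowsS IH /row (_ : n - k - _ = 0) ?cats0 //; lia.
Qed.

Lemma Qprime_rows (n k : nat) : Qprime n k = map (letter n) (rows n k n.+1).
Proof.
rewrite (_ : n.+1 = (n - k).-1 + (n.+1 - (n - k).-1)); last by lia.
rewrite rows_trunc /rows map_flatten -map_comp /Qprime /Qword filter_flatten.
rewrite -[1]addn0 iotaDl -!map_comp; congr flatten; apply: eq_map => t /=.
have := row_letters n k t predT; rewrite filter_predT => ->.
by rewrite filter_predT filter_rev; congr rev; apply: filter_iota => x; lia.
Qed.

Definition endpoints {n : nat} (d : diag n) : nat * nat := (val d.1, val d.2).

Lemma endpoints_inj {n : nat} : injective (@endpoints n).
Proof. by move=> [a b] [c d] [/val_inj -> /val_inj ->]. Qed.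

Lemma diag_list_rows (n k : nat) : map endpoints (diag_list n k) = rows n k n.+1.
Proof.
pose G (e : nat * nat) :=
  [&& 0 < e.1, e.1 < e.2, k < e.2 - e.1 & e.2 - e.1 < n - k].
have -> : diag_list n k = filter (preim endpoints G)
    [seq (i, j) | j <- rev (enum 'I_n.+1), i <- rev (enum 'I_n.+1)].
  by apply: eq_filter => d; rewrite inE.
rewrite -filter_map map_allpairs.
have -> : [seq endpoints (i, j) | j <- rev (enum 'I_n.+1), i <- rev (enum 'I_n.+1)] =
    [seq (i, j) | j <- map val (rev (enum 'I_n.+1)), i <- map val (rev (enum 'I_n.+1))].
  by rewrite allpairs_mapl allpairs_mapr.
rewrite map_rev val_enum_ord filter_flatten -map_comp.
have {2}-> : rev (iota 0 n.+1) = [seq n - t | t <- iota 0 n.+1].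
  apply: (@eq_from_nth _ 0); rewrite size_rev ?size_map // size_iota => i ilt.
  by rewrite nth_rev ?size_iota // (nth_map 0) ?size_iota // !nth_iota //; lia.
rewrite -map_comp; congr flatten; apply/eq_in_map => t.
rewrite mem_iota add0n => /andP[_ tn].
rewrite [LHS]filter_map filter_rev /row.
set c := maxn _ _; set l := n - k - c.
(* For [j = n - t] the condition [G] cuts out the interval [c - t <= i < n - k - t]; adding [t]
   gives the letters of the row. *)
rewrite (filter_iota _ _ _ (c - t) l); last by move=> x; rewrite /G /=; lia.
have {2}-> : c = t + (c - t) by lia.
rewrite iotaDl -map_rev -map_comp; apply: eq_map => x /=.
by rewrite addKn.
Qed.

Lemma diag_list_uniq (n k : nat) : uniq (diag_list n k).
Proof.
apply: filter_uniq; apply: allpairs_uniq; rewrite ?rev_uniq ?enum_uniq //.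
by move=> [a b] [c d] _ _ [-> ->].
Qed.

Lemma mem_diag_list (n k : nat) : Gamma n k =i diag_list n k.
Proof.
move=> d; rewrite mem_filter; case: (d \in Gamma n k) => //=.
apply/esym/allpairsP; exists (d.2, d.1).
by rewrite !mem_rev !mem_enum -surjective_pairing.
Qed.

(** Stated on pairs of naturals so that it can serve as the deleted set [D] of [profile]. *)
Definition occupied {n : nat} (S : {set diag n}) (e : nat * nat) : bool :=
  e \in map endpoints (enum S).

Lemma occupied_endpoints {n : nat} (S : {set diag n}) (d : diag n) :
  occupied S (endpoints d) = (d \in S).
Proof. by rewrite /occupied (mem_map endpoints_inj) mem_enum. Qed.

Lemma size_Qprime (n k : nat) : size (Qprime n k) = size (diag_list n k).
Proof. by rewrite Qprime_rows -diag_list_rows !size_map. Qed.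

(** As [diag_list] has no repetition, omitting positions of [F] amounts to omitting their
    diagonals. *)
Lemma compl_subword_rows (n k : nat) (F : {set 'I_(size (Qprime n k))}) :
  compl_subword (Qprime n k) F =
  map (letter n) [seq e <- rows n k n.+1
    | ~~ occupied [set nth (d0 n) (diag_list n k) (val p) | p in F] e].
Proof.
set S := [set _ | _ in F].
have FE p : (p \in F) = (nth (d0 n) (diag_list n k) (val p) \in S).
  apply/idP/imsetP => [pF|[q qF]]; first by exists p.
  have lt (r : 'I_(size (Qprime n k))) : r < size (diag_list n k).
    by rewrite -size_Qprime.
  move/eqP; rewrite nth_uniq ?diag_list_uniq ?lt //.
  by move/eqP/val_inj => ->.
rewrite /compl_subword.
rewrite (_ : [seq _ | _ <- enum _] = [seq d \notin S | d <- diag_list n k]); last first.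
  transitivity [seq nth (d0 n) (diag_list n k) p \notin S
               | p <- map val (enum 'I_(size (Qprime n k)))].
    by rewrite -map_comp; apply: eq_map => p /=; rewrite FE.
  by rewrite val_enum_ord size_Qprime
    -[in RHS](mkseq_nth (d0 n) (diag_list n k)) -map_comp.
rewrite Qprime_rows -diag_list_rows -!map_mask -filter_mask filter_map.
congr map; congr map.
by apply: eq_filter => d /=; rewrite -occupied_endpoints.
Qed.

(** * Sorting and crossings *)


Lemma nth_pi (n k x : nat) : 2 * k + 1 <= n -> x < n - k ->
  nth 0 (pi_nk n k) x = if x < k then x.+1 else n - x.
Proof.
move=> kn xn; rewrite nth_cat size_iota; case: ltnP => kx.
  by rewrite nth_iota.
by rewrite nth_rev ?size_iota ?nth_iota; lia.
Qed.

(** Each value [e >= k] goes to place [n - e.+1], so all values [>= B] lie in the first [n - B]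
    places. *)
Lemma height_pi (n k B : nat) (w : seq nat) : 2 * k + 1 <= n -> k <= B ->
  represents (n - k) w (pi_nk n k) ->
  height (wprod (n - k) w) B (n - B) = n - k - B.
Proof.
move=> kn kB repr; rewrite -(@height1_le (n - k) B (n - k)) //.
apply: eq_card => e; rewrite !inE perm1 ltn_ord andbT.
have eN := ltn_ord e; have := repr e; rewrite nth_pi //.
by case: ifP; lia.
Qed.

(** Letters above [k] fix the values below [k]. For the others the counts force [s e < n - e], and
    injectivity turns this into equality by induction from the largest value down. *)
Lemma represents_pi (n k : nat) (w : seq nat) : 2 * k + 1 <= n ->
  all (fun a => k < a < n - k) w ->
  (forall B, k < B < n - k -> n - k - B <= height (wprod (n - k) w) B (n - B)) ->
  represents (n - k) w (pi_nk n k).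
Proof.
move=> kn okw; set s := wprod _ _ => hs.
have sfix (e : 'I_(n - k)) : e < k -> s e = e by exact: wprod_fix.
have sge (e : 'I_(n - k)) : k <= e -> k <= s e.
  apply: contraTT; rewrite -!ltnNge => ek.
  by rewrite -(perm_inj (sfix _ ek)).
have sle (e : 'I_(n - k)) : k <= e -> s e < n - e.
  (* At [e = k] the bound [n - k] is just the number of places. *)
  rewrite leq_eqVlt => /predU1P[<-|ke]; first by have := ltn_ord (s e); lia.
  have eN := ltn_ord e; have hse : n - k - e <= height s e (n - e).
    by apply: hs; rewrite ke.
  have : [set f : 'I_(n - k) | (e <= f) && (s f < n - e)] ==
         [set f : 'I_(n - k) | (e <= f) && ((1 : {perm 'I_(n - k)})%g f < n - k)].
    rewrite eqEcard -/(height s e _) -/(height 1%g e _) height1_le // hse andbT.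
    by apply/subsetP=> f; rewrite !inE perm1 ltn_ord andbT => /andP[].
  by move/eqP/setP/(_ e); rewrite !inE perm1 ltn_ord leqnn /= => ->.
have srev (e : 'I_(n - k)) : k <= e -> s e = n - e.+1 :> nat.
  have [m] := ubnP (n - e); elim: m e => // m IH e em ke.
  have := sle e ke; have := sge e ke; have eN := ltn_ord e => ge le.
  (* The larger value [n - (s e).+1] already occupies place [s e] by induction. *)
  apply/eqP; apply: contraT => ne; have e'N : n - (s e).+1 < n - k by lia.
  have := IH (Ordinal e'N); rewrite /= => /(_ _ _)sE.
  have : s (Ordinal e'N) = s e by apply: val_inj; rewrite /= sE; lia.
  by move/perm_inj/(congr1 val) => /=; lia.
move=> e; rewrite nth_pi ?ltn_ord //; have eN := ltn_ord e.
by case: ifP => ek; [rewrite sfix | rewrite srev; lia].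
Qed.

Lemma rows_letters (n k t : nat) (P : pred (nat * nat)) :
  all (fun a => k < a < n - k) (map (letter n) (filter P (rows n k t))).
Proof.
elim: t => // t IH; rewrite rowsS filter_cat map_cat all_cat IH row_letters.
apply/allP => x; rewrite mem_filter mem_rev mem_iota => /andP[_] /=; lia.
Qed.

(** The heights of any subword are at most those of the network, which gives necessity. The greedy
    subword attains them, and it is reduced because its length is at most its number of
    inversions. *)
Lemma reduced_subword_profile (n k : nat) (D : pred (nat * nat)) :
  1 <= k -> 2 * k + 1 <= n ->
  (exists w, subseq w (map (letter n) [seq e <- rows n k n.+1 | ~~ D e]) /\
     reduced_for (n - k) w (pi_nk n k)) <->
  (forall B, k < B < n - k -> n - k - B <= profile n k D B (n - B) (n - B)).
Proof.
move=> k0 kn; set r := map _ _.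
have okr : all (fun a => k < a < n - k) r by exact: rows_letters.
have okr' : letters_ok (n - k) r by apply: sub_all okr => a; lia.
have profE B : network (subn^~ B) r (n - B) = profile n k D B (n - B) (n - B).
  by rewrite -(profile_stable _ _ _ _ n.+1) //; lia.
split=> [[w [wr [_ repr _]]] B kB|hB].
  rewrite -profE -(height_pi n k B w) //; last by lia.
  rewrite -[wprod _ _]mul1g; apply: height_subseq_le wr _ => // y.
  exact: height1_ub.
have [w [wr szw hw]] := greedy_subword r (1 : {perm 'I_(n - k)}) okr'.
rewrite mul1g in szw hw.
have okw : all (fun a => k < a < n - k) w.
  by apply/allP => a /(mem_subseq wr); apply: (allP okr).
exists w; split=> //.
have repr : represents (n - k) w (pi_nk n k).
  apply: represents_pi => // B kB; rewrite (hw B _ (subn^~ B)); last by lia.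
    by rewrite profE hB.
  by move=> y yN; rewrite height1_le.
split=> // [|w' okw' repr']; first by apply: sub_all okw => a; lia.
have wE : wprod (n - k) w = wprod (n - k) w'.
  by apply/permP => x; apply: val_inj; apply: succn_inj; rewrite repr repr'.
apply: leq_trans (card_inversions_wprod _ okw').
by rewrite -wE; apply: leq_trans szw; exact: leq_addr.
Qed.

Lemma path_nested_last (e : nat * nat) (s : seq (nat * nat)) :
  path nested e s -> [/\ e.1 + size s <= (last e s).1, e.2 + size s <= (last e s).2 &
    all (fun d => d.1 <= (last e s).1) (e :: s)].
Proof.
elim: s e => [|f s IH] e /=; first by rewrite !addn0 leqnn.
case/andP=> /andP[ef1 ef2] /IH[l1 l2 /= /andP[f1 all1]].
by rewrite f1 all1; split=> //; lia.
Qed.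

(** Sorted by first endpoint, mutually crossing diagonals interleave, so the second endpoints
    increase too. As [0 < k], the first and last are distinct and cross, whence the final
    inequality. *)
Lemma crossing_chain {n : nat} (k : nat) (C : {set diag n}) :
  0 < k -> #|C| = k.+1 ->
  {in C &, forall d e, d != e -> crosses n d e} ->
  exists e s, [/\ path nested e s, size s = k, all (occupied C) (e :: s) &
                  (last e s).1 < e.2].
Proof.
move=> k0 cardC crossC.
pose le1 (d e : diag n) := d.1 <= e.1.
pose inter (d e : nat * nat) := [&& d.1 < e.1, e.1 < d.2 & d.2 < e.2].
pose s0 := sort le1 (enum C).
have memC d : (d \in s0) = (d \in C) by rewrite mem_sort mem_enum.
have: pairwise inter (map endpoints s0).
  have: pairwise [rel d e | le1 d e && (d != e)] s0.
    rewrite pairwise_relI -uniq_pairwise sort_uniq enum_uniq andbT.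
    rewrite -sorted_pairwise; first by apply: sort_sorted => d e; exact: leq_total.
    by move=> d e f; exact: leq_trans.
  rewrite pairwise_map; apply: (@sub_in_pairwise _ [in C]);
    last by apply/allP => d; rewrite memC.
  move=> d e dC eC /= /andP[].
  by rewrite /le1 => de ne; have := crossC d e dC eC ne; rewrite /crosses /inter /=; lia.
have : size (map endpoints s0) = k.+1 by rewrite size_map size_sort -cardE.
have : all (occupied C) (map endpoints s0).
  by rewrite all_map; apply/allP => d; rewrite memC /= occupied_endpoints.
case: (map endpoints s0) => //= e s /andP[eC sC] [szs] /andP[es ss].
exists e, s; split=> //; last 2 first.
- by rewrite /= eC.
- case: s szs es {sC ss} => [|f s] szs; first by rewrite -szs in k0.
  by move/allP/(_ _ (mem_last f s))/and3P => [].
apply/(@pairwise_sorted _ nested (e :: s)).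
have sub : subrel inter nested by move=> d f /and3P[df _ df']; rewrite /nested df.
by rewrite /= (sub_all _ es) ?(sub_pairwise sub ss) // => d; exact: sub.
Qed.

(** The threshold [B] separates all first endpoints from all second ones, so nested pairs
    interleave. *)
Lemma chain_crossing {n : nat} (B : nat) (S : {set diag n}) (s : seq (nat * nat)) :
  sorted nested s -> all (occupied S) s ->
  all (fun e => (e.1 <= B) && (B < e.2)) s -> has_crossing n (size s) S.
Proof.
move=> ss Ss Bs; have nested_trans : transitive nested.
  by move=> e d f /andP[? ?] /andP[? ?]; rewrite /nested; lia.
have us : uniq s by apply: sorted_uniq ss => // e; rewrite /nested ltnn.
exists [set d | endpoints d \in s]; split.
- by apply/subsetP => d; rewrite inE => /(allP Ss); rewrite occupied_endpoints.
- rewrite cardE -(size_map endpoints); apply/perm_size/uniq_perm => //.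
    by rewrite map_inj_uniq ?enum_uniq //; exact: endpoints_inj.
  move=> e; apply/mapP/idP => [[d]|es]; first by rewrite mem_enum inE => ds ->.
  by have /mapP[d _ eE] := allP Ss e es; exists d; rewrite // mem_enum inE -eE.
- move=> d e; rewrite !inE => ds es; rewrite -(inj_eq endpoints_inj) => ne.
  have /andP[dB Bd] := allP Bs _ ds; have /andP[eB Be] := allP Bs _ es.
  have : nested (endpoints d) (endpoints e) || nested (endpoints e) (endpoints d).
    have := ss; rewrite sorted_pairwise // => /(pairwiseP (0, 0)) pw.
    have := pw (index (endpoints d) s) (index (endpoints e) s).
    have := pw (index (endpoints e) s) (index (endpoints d) s).
    rewrite !inE !index_mem !nth_index // => /(_ es ds) h1 /(_ ds es) h2.
    case: (ltngtP (index (endpoints d) s) (index (endpoints e) s))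
      => [/h2 ->|/h1 ->|iE] //.
      by rewrite orbT.
    by case/eqP: ne; rewrite -(nth_index (0, 0) ds) iE nth_index.
  by move: dB Bd eB Be; rewrite /nested /crosses /=; lia.
Qed.

Lemma has_crossing_sub {n m : nat} (S T : {set diag n}) :
  S \subset T -> has_crossing n m S -> has_crossing n m T.
Proof. by move=> ST [C [CS cC xC]]; exists C; rewrite (subset_trans CS ST). Qed.

Definition has_crossingb (n m : nat) (S : {set diag n}) : bool :=
  [exists C : {set diag n}, [&& C \subset S, #|C| == m &
    [forall d in C, forall e in C, (d != e) ==> crosses n d e]]].

Lemma has_crossingP {n m : nat} (S : {set diag n}) :
  reflect (has_crossing n m S) (has_crossingb n m S).
Proof.
apply: (iffP existsP) => -[C].
  case/and3P=> CS /eqP cC /forall_inP xC; exists C; split=> // d e dC eC ne.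
  by have /forall_inP/(_ e eC)/implyP := xC d dC; apply.
case=> CS cC xC; exists C; rewrite CS cC eqxx /=.
by apply/forall_inP => d dC; apply/forall_inP => e eC; apply/implyP; exact: xC.
Qed.

(** Avoiding crossings passes to subsets, and by finiteness a set avoiding them extends to a maximal
    one. *)
Lemma kfaceP {n k : nat} (S : {set diag n}) :
  S \subset Gamma n k -> kface n k S <-> ~ has_crossing n k.+1 S.
Proof.
move=> SG; split=> [[T [[_ nT _] ST]]|nS]; first by move/(has_crossing_sub _ _ ST).
pose P (T : {set diag n}) := (T \subset Gamma n k) && ~~ has_crossingb n k.+1 T.
have PE (T : {set diag n}) :
    reflect (T \subset Gamma n k /\ ~ has_crossing n k.+1 T) (P T).
  apply: (iffP andP) => -[TG nT]; split=> //; last by apply/negP => /has_crossingP.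
  by move/has_crossingP; exact/negP.
have [T /maxsetP[/PE[TG nT] maxT] ST] :=
  @maxset_exists _ P S (introT (PE S) (conj SG nS)).
exists T; split=> //; split=> // T' TT' T'G nT'.
by apply: maxT => //; apply/PE.
Qed.

Lemma crossing_profile {n k : nat} (S : {set diag n}) :
  1 <= k -> 2 * k + 1 <= n -> S \subset Gamma n k ->
  ~ has_crossing n k.+1 S <->
  (forall B, k < B < n - k ->
     n - k - B <= profile n k (occupied S) B (n - B) (n - B)).
Proof.
move=> k0 kn SG; split=> [nX B kB|hB [C [CS cC xC]]].
  rewrite leqNgt; apply/negP => lt; apply: nX.
  have nB : (n - B.+1).+1 = n - B by lia.
  (* With [d = k] and [t.+1 = n - B], the deficiency bound [t.+1 - d] is exactly [n - k - B]. *)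
  have := profile_lt_chain n k (occupied S) B k (n - B.+1) (n - B).
  rewrite nB => /(_ _ _ _ _ _ _)[]; try lia.
  move=> s [szs ss Ss Bs]; rewrite -szs; apply: (chain_crossing B) => //.
  by apply: sub_all Bs => e /and4P[_ -> ->].
have [e [s [es szs Cs lt]]] := crossing_chain k C k0 cC xC.
have [l1 l2 le1] := path_nested_last e s es.
have inS d : occupied C d -> [&& 0 < d.1, d.2 <= n & occupied S d].
  case/mapP => f; rewrite mem_enum => /(subsetP CS) fS ->.
  rewrite occupied_endpoints fS andbT.
  have := subsetP SG f fS; rewrite inE => /andP[f0 _].
  by apply/andP; split; last exact: ltn_ord f.2.
have /andP[eC sC] := Cs; have /and3P[e0 en _] := inS e eC.
have /and3P[_ ln _] : [&& 0 < (last e s).1, (last e s).2 <= n & occupied S (last e s)].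
  by apply: inS; apply: (allP Cs); exact: mem_last.
(* The failing threshold is the largest first endpoint. It exceeds [k] because [k] strict steps lead
   to it from [e.1 >= 1], and it is below [n - k] because [B < e.2] and [e.2 + k <= n]. *)
have := hB (last e s).1 _; set B := (last e s).1 in l1 lt le1 *.
have kB : k < B < n - k by lia.
move=> /(_ kB); have nB : (n - B.+1).+1 = n - B by lia.
have := profile_chain_le n k (occupied S) B e s (n - B.+1) (n - B) es.
rewrite nB szs => ub lb; suff : n - k - B + k <= n - B.+1 by lia.
apply: leq_trans (ub _ _ _); rewrite ?leq_add2r //; try lia.
apply/allP => d dC; have /and3P[_ dn dS] := inS d (allP Cs d dC).
by rewrite /= dS dn (allP le1 d dC).
Qed.

Theorem theorem2p1 (n k : nat) : 1 <= k -> 2 * k + 1 <= n ->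
  [/\ size (Qprime n k) = size (diag_list n k),
      uniq (diag_list n k),
      Gamma n k =i diag_list n k,
      (forall p, p < size (Qprime n k) ->
         nth 0 (Qprime n k) p =
         n - (nth (d0 n) (diag_list n k) p).2 + (nth (d0 n) (diag_list n k) p).1)
    & forall F : {set 'I_(size (Qprime n k))},
        subword_face (n - k) (Qprime n k) (pi_nk n k) F <->
        kface n k [set nth (d0 n) (diag_list n k) (val p) | p in F]].
Proof.
move=> k0 kn; split; first exact: size_Qprime.
- exact: diag_list_uniq.
- exact: mem_diag_list.
- move=> p; rewrite size_Qprime => pn.
  by rewrite Qprime_rows -diag_list_rows -map_comp (nth_map (d0 n)).
- move=> F; rewrite /subword_face compl_subword_rows.
  (* Both sides become the same condition on [profile], with the diagonals of [F] deleted. *)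
  rewrite (reduced_subword_profile n k _ k0 kn).
  have SG : [set nth (d0 n) (diag_list n k) (val p) | p in F] \subset Gamma n k.
    apply/subsetP => d /imsetP[p _ ->]; rewrite mem_diag_list mem_nth //.
    by rewrite -size_Qprime; exact: ltn_ord p.
  by rewrite -(crossing_profile _ k0 kn SG) (kfaceP _ SG).
Qed.
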